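(* Let $\mathcal{A}$ be any deterministic algorithm (in the comparison-based model described in the context) that correctly constructs the convex hull of $P$ for every planar point set $P$ of size $n$, when given as input a sequence $I$ of size $m=3n$ that stores all points of $P$ (points of $P$ may appear several times in $I$) and that has a subsequence consisting of the vertices of the convex hull of $P$ sorted by $x$-coordinate. Then in the worst case over such inputs $\mathcal{A}$ requires $\Omega(n\log n)$ comparisons. In particular, the convex hull of $P$ cannot in general be computed in $o(n\log n)$ time from such a sequence of size $m\in O(n)$.
   Context: The convex hull of $P$ is output as its vertices in cyclic order. Model of computation. For each fixed input size, an algorithm specifies a (RAM) programme, i.e. a list of instructions. Instructions can manipulate memory, halt the programme, or make comparisons. There are two types of comparisons: (i) coordinate comparisons, comparing the $x$-coordinates or the $y$-coordinates of two entries of the input sequence; (ii) orientation tests, evaluating whether an entry of the input sequence lies strictly above the line through two other entries. A comparison returns a Boolean; if true, the programme jumps to an instruction specified by the algorithm, and otherwise continues with the next instruction. Non-comparison instructions have inputs defined independently of the input points (coordinates cannot be manipulated). *)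

(* Defs.v *)
From mathcomp Require Import all_boot all_order all_algebra finmap.
From mathcomp Require Import all_classical all_reals all_analysis.

Set Implicit Arguments.
Unset Strict Implicit.
Unset Printing Implicit Defensive.

Import Order.TTheory GRing.Theory Num.Theory.

Local Open Scope classical_set_scope.
Local Open Scope ring_scope.
Local Open Scope convex_scope.

(* [R^o] (rather than [R]) makes the plane an [lmodType R]. *)
Notation point R := (R^o * R^o)%type.

Definition convex_hull (R : realType) (P : {fset point R}) : set (point R) :=
  smallest (@convex_set R (point R)) [set p | p \in P].

(* The vertices of the convex hull are its extreme points; in particular, a
   point of P in the relative interior of a hull edge is not a vertex. *)
Definition hull_vertex (R : realType) (P : {fset point R}) (p : point R) : Prop :=
  convex_hull P p /\
  forall (a b : convex_lmodType (point R)) (t : {i01 R}),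
    convex_hull P a -> convex_hull P b -> 0 < t%:num < 1 ->
    p = a <| t |> b -> a = b.

Definition lists_vertices (R : realType) (P : {fset point R})
    (s : seq (point R)) : Prop :=
  uniq s /\ forall p, p \in s <-> hull_vertex P p.

(* Twice the signed area of the triangle abp, which is nonnegative iff p is not
   strictly to the right of the directed line from a to b: consecutive points
   a, b of a counterclockwise traversal span an edge with P on its left. *)
Definition left_edge (R : realType) (P : {fset point R}) (a b : point R) : bool :=
  [forall p : P,
     0 <= (b.1 - a.1) * ((val p).2 - a.2) - (b.2 - a.2) * ((val p).1 - a.1)].

(* Either direction of traversal and any starting vertex is accepted. *)
Definition is_hull_output (R : realType) (P : {fset point R})
    (s : seq (point R)) : Prop :=
  lists_vertices P s /\ (cycle (left_edge P) s \/ cycle (left_edge P) (rev s)).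

Definition valid_input (R : realType) (n m : nat) (P : {fset point R})
    (I : m.-tuple (point R)) : Prop :=
  [/\ #|` P|%fset = n, I =i P &
      exists s, [/\ subseq s I, lists_vertices P s &
                    sorted (fun p q : point R => p.1 <= q.1) s]].

(* The line through p and q passes at height
   p.2 + (q.2 - p.2) / (q.1 - p.1) * (r.1 - p.1) over the abscissa of r.
   No point is above a vertical line (nor above the "line" through p and p). *)
Definition strictly_above (R : realType) (p q r : point R) : bool :=
  (p.1 != q.1) && (p.2 + (q.2 - p.2) / (q.1 - p.1) * (r.1 - p.1) < r.2).

(* The memory never holds coordinates; entries of the input sequence are
   referred to by their positions. *)
Definition memory : Type := nat -> nat.

(* Operands may be addressed indirectly, so the position of an entry in the
   input of size m is computed from the memory. *)
Definition operand (m : nat) : Type := memory -> 'I_m.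

Inductive comparison (m : nat) : Type :=
| CompareX of operand m & operand m
| CompareY of operand m & operand m
| Orientation of operand m & operand m & operand m.

(* No instruction set is fixed for the memory: any map is allowed.
   [Compare q l] jumps to instruction number l when q evaluates to true.
   [Halt out] reports the sequence of entries that out reads off the memory. *)
Inductive instruction (m : nat) : Type :=
| Update of (memory -> memory)
| Compare of comparison m & nat
| Halt of (memory -> seq 'I_m).

Definition program (m : nat) : Type := seq (instruction m).

Definition algorithm : Type := forall m : nat, program m.

Definition eval_comparison (R : realType) (m : nat) (I : m.-tuple (point R))
    (M : memory) (q : comparison m) : bool :=
  match q with
  | CompareX i j => (tnth I (i M)).1 < (tnth I (j M)).1
  | CompareY i j => (tnth I (i M)).2 < (tnth I (j M)).2
  | Orientation i j k =>
      strictly_above (tnth I (i M)) (tnth I (j M)) (tnth I (k M))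
  end.

(* [exec prog I pc M t c out]: started at instruction number pc with memory M,
   the run halts with output out after executing t instructions, c of which are
   comparisons.  A run that leaves the programme does not halt. *)
Inductive exec (R : realType) (m : nat) (prog : program m)
    (I : m.-tuple (point R)) : nat -> memory -> nat -> nat -> seq 'I_m -> Prop :=
| exec_halt pc M f :
    onth prog pc = Some (Halt f) -> exec prog I pc M 1 0 (f M)
| exec_update pc M f t c out :
    onth prog pc = Some (Update m f) ->
    exec prog I pc.+1 (f M) t c out -> exec prog I pc M t.+1 c out
| exec_compare pc M q l t c out :
    onth prog pc = Some (Compare q l) ->
    exec prog I (if eval_comparison I M q then l else pc.+1) M t c out ->
    exec prog I pc M t.+1 c.+1 out.

Definition runs (R : realType) (A : algorithm) (m : nat)
    (I : m.-tuple (point R)) (t c : nat) (out : seq 'I_m) : Prop :=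
  exec (A m) I 0 (fun=> 0%N) t c out.

(* m n is the size of the input sequence for point sets of size n. *)
Definition correct (R : realType) (m : nat -> nat) (A : algorithm) : Prop :=
  forall (n : nat) (P : {fset point R}) (I : (m n).-tuple (point R)),
    valid_input n P I ->
    exists t c out, runs A I t c out /\ is_hull_output P [seq tnth I i | i <- out].

Definition comparisons_Omega_nlogn (R : realType) (m : nat -> nat)
    (A : algorithm) : Prop :=
  exists2 k : R, 0 < k & exists N : nat, forall n : nat, (N <= n)%N ->
    exists (P : {fset point R}) (I : (m n).-tuple (point R)) t c out,
      [/\ valid_input n P I, runs A I t c out & k * (n%:R * ln n%:R) <= c%:R].

Definition time_o_nlogn (R : realType) (m : nat -> nat) (A : algorithm) : Prop :=
  forall e : R, 0 < e -> exists N : nat, forall n : nat, (N <= n)%N ->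
    forall (P : {fset point R}) (I : (m n).-tuple (point R)) t c out,
      valid_input n P I -> runs A I t c out -> t%:R <= e * (n%:R * ln n%:R).

Definition linearly_bounded (m : nat -> nat) : Prop :=
  exists C N : nat, forall n : nat, (N <= n)%N -> (m n <= C * n)%N.

(* Main.v *)
Require Import Defs.
From mathcomp Require Import all_boot all_order all_algebra.
From mathcomp Require Import all_classical all_reals all_analysis.
From mathcomp Require Import finmap fingroup.perm ring lra zify.
(* MathComp's [point] (of a pointed type) would otherwise hide the plane. *)
Import Defs.

Set Implicit Arguments.
Unset Strict Implicit.
Unset Printing Implicit Defensive.

Import Order.TTheory GRing.Theory Num.Theory.

Local Open Scope ring_scope.
Local Open Scope convex_scope.

(* The vertices V_0, V_1, ... lie on the parabola y = -x^2 at even abscissas,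
   and Q_j is the midpoint of the edge from V_{pi(j)} to V_{pi(j)+1}, for a
   permutation pi of k ~ n/2 elements.  In the input V Q V (padded) every single
   Q_j may be lifted to the parabola, where it becomes a hull vertex: the sorted
   hull is then read off by leaving the first copy of V at V_{pi(j)} and
   re-entering the second one after Q_j.  The lift changes only the orientation
   test of Q_j against the edge pi(j), so a correct run on the unlifted input
   must perform this test for every j.  Hence pi is determined by the answers of
   the run together with one bit per comparison marking these tests, so that
   k! <= 4^c if all runs make at most c comparisons. *)

(** * Execution traces and determinism of runs *)

(** Each comparison is stored with the memory at that moment, since operands are addressed through
    the memory. Answers are not stored: they can be recomputed from the input. *)
Inductive exec_trace (R : realType) (m : nat) (prog : program m)
    (I : m.-tuple (point R)) :
    nat -> memory -> seq (memory * comparison m) -> seq 'I_m -> Prop :=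
| trace_halt pc M f :
    onth prog pc = Some (Halt f) -> exec_trace prog I pc M [::] (f M)
| trace_update pc M f tr out :
    onth prog pc = Some (Update m f) ->
    exec_trace prog I pc.+1 (f M) tr out -> exec_trace prog I pc M tr out
| trace_compare pc M q l tr out :
    onth prog pc = Some (Compare q l) ->
    exec_trace prog I (if eval_comparison I M q then l else pc.+1) M tr out ->
    exec_trace prog I pc M ((M, q) :: tr) out.

Lemma exec_exec_trace (R : realType) (m : nat) (prog : program m)
    (I : m.-tuple (point R)) pc M t c out :
  exec prog I pc M t c out ->
  exists2 tr, size tr = c & exec_trace prog I pc M tr out.
Proof.
elim=> {pc M t c out} [pc M f e|pc M f t c out e _ [tr <- h]|
  pc M q l t c out e _ [tr <- h]].
- by exists [::] => //; apply: trace_halt.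
- by exists tr => //; apply: trace_update e h.
- by exists ((M, q) :: tr) => //; apply: trace_compare e h.
Qed.

Lemma exec_comparisons_le_time (R : realType) (m : nat) (prog : program m)
    (I : m.-tuple (point R)) pc M t c out :
  exec prog I pc M t c out -> (c <= t)%N.
Proof.
elim=> {pc M t c out} // pc M f t c out _ _ h; exact: leqW.
Qed.

(** Two runs stay in the same state as long as their answers agree. Agreement is only required at
    positions where the traces coincide, because at a first divergent answer both runs would still
    be performing the same comparison. *)
Lemma exec_trace_inj (R : realType) (m : nat) (prog : program m)
    (I I' : m.-tuple (point R)) pc M tr out tr' out' :
  exec_trace prog I pc M tr out -> exec_trace prog I' pc M tr' out' ->
  (forall i e, onth tr i = Some e -> onth tr' i = Some e ->
     eval_comparison I e.1 e.2 = eval_comparison I' e.1 e.2) ->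
  tr = tr' /\ out = out'.
Proof.
move=> h; elim: h tr' out' => {pc M tr out}
  [pc M f e|pc M f tr out e _ IH|pc M q l tr out e _ IH] tr' out' h'.
- by case: h' e => {pc M tr' out'} [pc M g e'|pc M g tr' out' e' h'|
    pc M q' l' tr' out' e' h']; rewrite e' => // -[->].
- case: h' e IH => {pc M tr' out'} [pc M g e'|pc M g tr' out' e' h'|
    pc M q' l' tr' out' e' h']; rewrite e' => // -[<-] IH.
  exact: IH.
- case: h' e IH => {pc M tr' out'} [pc M g e'|pc M g tr' out' e' h'|
    pc M q' l' tr' out' e' h']; rewrite e' => // -[<- <-] IH agree.
  have agree0 := agree 0%N _ erefl erefl; rewrite /= in agree0.
  rewrite agree0 in IH.
  have [i e'' | -> ->] := IH _ _ h'; last by [].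
  exact: (agree i.+1 e'').
Qed.

(** * Extreme points of convex hulls in the plane *)

Lemma conv_coordinates (R : realType) (a b : convex_lmodType (point R))
    (t : {i01 R}) :
  (a <| t |> b).1 = t%:num * a.1 + (1 - t%:num) * b.1 /\
  (a <| t |> b).2 = t%:num * a.2 + (1 - t%:num) * b.2.
Proof. by []. Qed.

Lemma sub_convex_hull (R : realType) (P : {fset point R}) (p : point R) :
  p \in P -> convex_hull P p.
Proof. by move=> pP A [_]; apply. Qed.

Lemma convex_hull_convex (R : realType) (P : {fset point R})
    (a b : convex_lmodType (point R)) (t : {i01 R}) :
  convex_hull P a -> convex_hull P b -> convex_hull P (a <| t |> b).
Proof.
move=> ha hb A [cA PA].
by apply/set_mem/cA; apply/mem_set; [apply: ha|apply: hb].
Qed.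

Lemma convex_hull_ind (R : realType) (P : {fset point R})
    (Q : point R -> Prop) :
  (forall p, p \in P -> Q p) ->
  (forall (a b : convex_lmodType (point R)) (t : {i01 R}),
     0 < t%:num < 1 -> Q a -> Q b -> Q (a <| t |> b)) ->
  forall p, convex_hull P p -> Q p.
Proof.
move=> QP Qconv p; apply; split=> //.
apply/(@convex_setW R (point R)) => a b /set_mem Qa /set_mem Qb t t0 t1.
by apply/mem_set/Qconv => //; rewrite t0.
Qed.

(** Removing an extreme point [p] from the hull leaves a convex set. If [p] were not in [P], this
    set would still contain [P], against minimality of the hull. *)
Lemma hull_vertex_mem (R : realType) (P : {fset point R}) (p : point R) :
  hull_vertex P p -> p \in P.
Proof.
case=> hp extreme; apply/negP => pP.
suff: forall q, convex_hull P q -> convex_hull P q /\ q <> p.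
  by move/(_ p hp) => [].
apply: convex_hull_ind => [q qP|a b t t01 [ha ap] [hb bp]].
  by split; [exact: sub_convex_hull|move=> qp; apply: pP; rewrite -qp].
split; first exact: convex_hull_convex.
move=> e; have ab := extreme a b t ha hb t01 (esym e).
by apply: ap; rewrite -e -ab convmm.
Qed.

Lemma midpoint_not_hull_vertex (R : realType) (P : {fset point R})
    (a b p : point R) :
  a \in P -> b \in P -> a != b -> p.1 *+ 2 = a.1 + b.1 ->
  p.2 *+ 2 = a.2 + b.2 -> ~ hull_vertex P p.
Proof.
move=> aP bP /eqP ab e1 e2 [_ extreme]; apply: ab.
have h01 : 0 < (2^-1 : R) < 1 by apply/andP; split; lra.
have hle : 0 <= (2^-1 : R) <= 1 by apply/andP; split; lra.
apply: (extreme a b (Itv01 (proj1 (andP hle)) (proj2 (andP hle)))) => //;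
  try exact: sub_convex_hull.
move: (@conv_coordinates R a b (Itv01 (proj1 (andP hle)) (proj2 (andP hle)))).
case: conv => x y /= [-> ->]; case: p e1 e2 {extreme} => u v /= e1 e2.
congr pair; lra.
Qed.

(** The explicit defect term yields both the concavity of the parabola and its strictness. *)
Lemma sqr_conv (R : realFieldType) (t a b : R) :
  (t * a + (1 - t) * b) ^+ 2 =
  t * a ^+ 2 + (1 - t) * b ^+ 2 - t * (1 - t) * (a - b) ^+ 2.
Proof. ring. Qed.

(* The parabola is strictly concave, so its points are extreme in the region
   below it. *)
Lemma parabola_hull_vertex (R : realType) (P : {fset point R}) (p : point R) :
  (forall q, q \in P -> q.2 <= - q.1 ^+ 2) -> p \in P -> p.2 = - p.1 ^+ 2 ->
  hull_vertex P p.
Proof.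
move=> below pP onp; split=> [|a b t ha hb t01 e]; first exact: sub_convex_hull.
have {}below : forall q, convex_hull P q -> q.2 <= - q.1 ^+ 2.
  apply: convex_hull_ind => // {ha hb e t01 t}a {}b t /andP[t0 t1] ha hb.
  have [-> ->] := conv_coordinates a b t.
  have s0 : 0 < 1 - t%:num by rewrite subr_gt0.
  have := mulr_ge0 (mulr_ge0 (ltW t0) (ltW s0)) (sqr_ge0 (a.1 - b.1)).
  rewrite -(ler_pM2l t0) in ha; rewrite -(ler_pM2l s0) in hb.
  rewrite sqr_conv; lra.
move: (below _ ha) (below _ hb) => {ha hb}; have [] := conv_coordinates a b t.
rewrite -e; case/andP: t01 onp; move: t%:num => {e}t t0 t1.
case: a b p {below pP} => [a1 a2] [b1 b2] [p1 p2] /= -> -> e2 ha hb.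
have s0 : 0 < 1 - t by rewrite subr_gt0.
move: e2; rewrite sqr_conv => e2.
have ha' := ha; have hb' := hb.
rewrite -(ler_pM2l t0) in ha'; rewrite -(ler_pM2l s0) in hb'.
(* As [p] is on the parabola while [a] and [b] are not above it, the defect of [sqr_conv] is at most
   zero. *)
have ab1 : a1 = b1.
  apply/eqP; rewrite -subr_eq0 -sqrf_eq0 eq_le sqr_ge0 andbT.
  rewrite -(pmulr_rle0 _ (mulr_gt0 t0 s0)); lra.
rewrite ab1 subrr expr0n mulr0 in e2 ha ha' *.
(* Both ordinates are bounded by that of the parabola and average to it, so both attain it. *)
congr pair; apply/eqP; rewrite eq_le; apply/andP; split.
  rewrite -(ler_pM2l s0); lra.
rewrite -(ler_pM2l t0); lra.
Qed.

(** * The configurations on the parabola and what comparisons see of them *)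

(* [inl i] stands for V_i and [inr j] for Q_j. *)
Definition label (k : nat) : Type := (nat + 'I_k)%type.

Definition abscissa (k : nat) (pi : {perm 'I_k}) (l : label k) : nat :=
  match l with inl i => i.*2 | inr j => (pi j).*2.+1 end.

Definition on_parabola (k : nat) (o : option 'I_k) (l : label k) : bool :=
  if l is inr j then o == Some j else true.

(* [o = Some j] is the configuration in which Q_j is lifted to the parabola. *)
Definition place (R : realType) (k : nat) (pi : {perm 'I_k}) (o : option 'I_k)
    (l : label k) : point R :=
  ((abscissa pi l)%:R,
   - (abscissa pi l)%:R ^+ 2 - (~~ on_parabola o l)%:R).

(** Membership ignores the roles of the operands, so a test with Q_j as one of the points spanning
    the line counts as well. *)
Definition edge_test (k : nat) (pi : {perm 'I_k}) (s : seq (label k))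
    (j : 'I_k) : bool :=
  [&& inr j \in s, inl (nat_of_ord (pi j)) \in s & inl (pi j).+1 \in s].

Lemma abscissa_inj (k : nat) (pi : {perm 'I_k}) : injective (abscissa pi).
Proof.
move=> [i|j] [i'|j'] /= e; try lia.
- by congr inl; lia.
- by congr inr; apply/(@perm_inj _ pi)/val_inj => /=; lia.
Qed.

Lemma place_inj (R : realType) (k : nat) (pi : {perm 'I_k}) (o : option 'I_k) :
  injective (place R pi o).
Proof. by move=> a b [/eqP]; rewrite eqr_nat => /eqP /abscissa_inj. Qed.

Lemma place_ordinate (R : realType) (k : nat) (pi : {perm 'I_k})
    (o : option 'I_k) (l : label k) :
  (place R pi o l).2 = - (abscissa pi l ^ 2 + ~~ on_parabola o l)%:R.
Proof. by rewrite natrD natrX opprD. Qed.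

(** An unlifted point lies one unit below the parabola at a positive abscissa x, and x^2 + 1 < (x +
    1)^2. Hence ordinates decrease along abscissas whatever [o] is, and no coordinate comparison
    notices a lift. *)
Lemma lt_place_ordinate (R : realType) (k : nat) (pi : {perm 'I_k})
    (o : option 'I_k) (a b : label k) :
  ((place R pi o a).2 < (place R pi o b).2) = (abscissa pi b < abscissa pi a)%N.
Proof.
have below l : (~~ on_parabola o l <= abscissa pi l)%N.
  by case: l => //= j; case: eqP.
rewrite !place_ordinate ltrN2 ltr_nat.
have := below a; have := below b.
case: (ltngtP (abscissa pi b) (abscissa pi a)) => [ba|ab|/abscissa_inj ->];
  last by rewrite ltnn.
- by move: (nat_of_bool _) (nat_of_bool _) => u v; nia.
- by move: (nat_of_bool _) (nat_of_bool _) => u v; nia.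
Qed.

Lemma strictly_aboveE (R : realType) (p q r : point R) : p.1 < q.1 ->
  strictly_above p q r =
  (0 < (q.1 - p.1) * (r.2 - p.2) - (q.2 - p.2) * (r.1 - p.1)).
Proof.
move=> pq; rewrite /strictly_above lt_eqF //= subr_gt0 -ltrBrDl.
by rewrite mulrAC ltr_pdivrMr ?subr_gt0 // [X in _ < X]mulrC.
Qed.

Lemma strictly_aboveC (R : realType) (p q r : point R) :
  strictly_above p q r = strictly_above q p r.
Proof.
rewrite /strictly_above eq_sym; case: eqVneq => //= qp; congr (_ < _).
by field; rewrite !subr_eq0 qp eq_sym qp.
Qed.

(* The sign does not depend on [o]: only an edge test can notice a lift. *)
Lemma place_middle_above (R : realType) (k : nat) (pi : {perm 'I_k})
    (o : option 'I_k) (a b c : label k) (p := place R pi o) :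
  (abscissa pi a < abscissa pi b < abscissa pi c)%N ->
  (forall j, ~~ edge_test pi [:: a; b; c] j) ->
  0 < ((p c).1 - (p b).1) * ((p b).2 - (p a).2) -
      ((p c).2 - (p b).2) * ((p b).1 - (p a).1).
Proof.
move=> /andP[ab bc] noedge.
pose x := abscissa pi a; pose u := (abscissa pi b - x)%N.
pose v := (abscissa pi c - abscissa pi b)%N.
pose s l : nat := ~~ on_parabola o l.
have eb : abscissa pi b = (x + u)%N by rewrite /u; lia.
have ec : abscissa pi c = (x + u + v)%N by rewrite /v; lia.
(* The product u v (u + v) is the Vandermonde determinant of three points on the parabola; the other
   terms account for the drops [s] below it. *)
have -> : ((p c).1 - (p b).1) * ((p b).2 - (p a).2) -
      ((p c).2 - (p b).2) * ((p b).1 - (p a).1) =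
      (u * v * (u + v) + v * s a + u * s c)%:R - ((u + v) * s b)%:R.
  rewrite /p /place /= -/x eb ec -/(s a) -/(s b) -/(s c).
  by rewrite !(natrD, natrM); ring.
rewrite subr_gt0 ltr_nat.
have u0 : (0 < u)%N by rewrite /u; lia.
have v0 : (0 < v)%N by rewrite /v; lia.
suff : (s b < u * v)%N by move: (s a) (s b) (s c) => sa sb sc; nia.
have [sb|] := posnP (s b); first by rewrite sb muln_gt0 u0.
move=> sb0; have [j bj] : exists j, b = inr j.
  by move: sb0; rewrite /s; case: (b) => // j; exists j.
have {sb0}-> : s b = 1%N by move: sb0; rewrite /s; case: on_parabola.
(* Equality forces u = v = 1, so [a] and [c] are the ends of the edge below which the unlifted [b]
   would have been lifted: an edge test. *)
rewrite ltn_neqAle muln_gt0 u0 v0 andbT; apply/negP => /eqP uv.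
have [u1 v1] : u = 1%N /\ v = 1%N by nia.
have := noedge j; rewrite /edge_test.
have -> : a = inl (nat_of_ord (pi j)).
  by apply: (@abscissa_inj _ pi); rewrite bj /= in eb *; rewrite -/x; lia.
have -> : c = inl (pi j).+1.
  by apply: (@abscissa_inj _ pi); rewrite bj /= in eb *; rewrite ec; lia.
by rewrite bj !inE !eqxx !orbT.
Qed.

Lemma strictly_above_place (R : realType) (k : nat) (pi : {perm 'I_k})
    (o : option 'I_k) (a b c : label k) (x := abscissa pi) :
  (forall j, ~~ edge_test pi [:: a; b; c] j) ->
  strictly_above (place R pi o a) (place R pi o b) (place R pi o c) =
  (x a < x c < x b)%N || (x b < x c < x a)%N.
Proof.
wlog ab : a b / (x a < x b)%N => [hw|] noedge.
  case: (ltngtP (x a) (x b)) => [ab|ba|/abscissa_inj ->]; first exact: hw.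
    rewrite strictly_aboveC hw 1?orbC // => j.
    by have := noedge j; rewrite /edge_test !inE !(orbCA (_ == b)).
  by rewrite /strictly_above eqxx; lia.
rewrite strictly_aboveE ?ltr_nat //.
(* The three orders of the abscissas all reduce to [place_middle_above], applied to the operands in
   sorted order. *)
have perm_noedge s : perm_eq s [:: a; b; c] -> forall j, ~~ edge_test pi s j.
  by move=> ps j; rewrite /edge_test !(perm_mem ps); apply: noedge.
case: (ltngtP (x c) (x a)) => [ca|ac|/abscissa_inj ->].
- have := @place_middle_above R k pi o c a b.
  rewrite -/x ca ab => /(_ isT (perm_noedge _ _)).
  rewrite (perm_catC [:: c] [:: a; b]) => /(_ (perm_refl _)).
  have -> : (x b < x c)%N = false by lia.
  move: (place R pi o a) (place R pi o b) (place R pi o c) => p q r h.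
  by apply/negbTE; rewrite -leNgt; lra.
- case: (ltngtP (x c) (x b)) => [cb|bc|/abscissa_inj ->].
  + have := @place_middle_above R k pi o a c b.
    rewrite -/x ac cb => /(_ isT (perm_noedge _ _)).
    rewrite perm_cons (perm_catC [:: c] [:: b]) => /(_ (perm_refl _)).
    move: (place R pi o a) (place R pi o b) (place R pi o c) => p q r h.
    by lra.
  + have := @place_middle_above R k pi o a b c.
    rewrite -/x ab bc => /(_ isT noedge).
    move: (place R pi o a) (place R pi o b) (place R pi o c) => p q r h.
    by apply/negbTE; rewrite -leNgt; lra.
  + by rewrite [X in 0 < X](_ : _ = 0) ?ltxx //; lra.
- have -> : (x b < x a)%N = false by lia.
  by rewrite !subrr !mulr0 subrr ltxx.
Qed.

(** The three labels of an edge test are distinct, so they exhaust a list of size at most three. *)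
Lemma edge_test_mem (k : nat) (pi : {perm 'I_k}) (s : seq (label k))
    (j : 'I_k) (l : label k) :
  (size s <= 3)%N -> edge_test pi s j -> l \in s ->
  l \in [:: inr j; inl (nat_of_ord (pi j)); inl (pi j).+1].
Proof.
move=> s3 /and3P[sj s1 s2] sl; apply/negPn/negP => nl.
set t := [:: inr j; _; _] in nl.
suff /uniq_leq_size h : uniq (l :: t).
  by have /leq_trans/(_ s3) : (4 <= size s)%N by apply: h => x;
    rewrite !inE => /or4P[] /eqP ->.
rewrite /= nl !inE /= andbT.
by apply/eqP => -[]; lia.
Qed.

(** The operands of an edge test reveal both j and pi(j). This is why one bit marking a comparison
    as an edge test is enough to decode the permutation. *)
Lemma edge_test_inj (k : nat) (pi sigma : {perm 'I_k}) (s : seq (label k))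
    (i j : 'I_k) :
  (size s <= 3)%N -> edge_test pi s i -> edge_test sigma s j ->
  i = j /\ pi i = sigma j.
Proof.
move=> s3 ti tj; have tm := edge_test_mem s3 ti; have tm' := edge_test_mem s3 tj.
have /and3P[sj s1' _] := tj; have /and3P[_ s1 _] := ti.
split.
  by have := tm _ sj; rewrite !inE => /or3P[] /eqP // -[].
(* Each of [pi i] and [sigma j] equals the other or its successor, hence they are equal. *)
have := tm _ s1'; have := tm' _ s1; rewrite !inE /=.
move=> /orP[] /eqP[] e /orP[] /eqP[] e'; apply: val_inj => /=; lia.
Qed.

(** If Q_j is an operand, an edge test for another index is impossible as well, and the answer
    depends on abscissas alone. Otherwise no operand moves. *)
Lemma strictly_above_lift (R : realType) (k : nat) (pi : {perm 'I_k})
    (j : 'I_k) (a b c : label k) :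
  ~~ edge_test pi [:: a; b; c] j ->
  strictly_above (place R pi None a) (place R pi None b) (place R pi None c) =
  strictly_above (place R pi (Some j) a) (place R pi (Some j) b)
    (place R pi (Some j) c).
Proof.
move=> noedge; case jabc : (inr j \in [:: a; b; c]).
  have noedge' i : ~~ edge_test pi [:: a; b; c] i.
    apply: contra noedge => ti.
    have := @edge_test_mem k pi [:: a; b; c] i (inr j) isT ti jabc.
    by rewrite !inE => /or3P[] /eqP // -[->].
  by rewrite !strictly_above_place.
have stay l : l \in [:: a; b; c] -> place R pi None l = place R pi (Some j) l.
  case: l => // i iabc; rewrite /place /=; congr (_, _ - _%:R).
  by case: eqP => // -[ji]; rewrite ji iabc in jabc.
by rewrite !stay ?inE ?eqxx ?orbT.
Qed.

(** * The input sequence and its validity *)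

Definition vertices (h k : nat) : seq (label k) := [seq inl i | i <- iota 0 h].

Lemma size_ord_enum (k : nat) : size (ord_enum k) = k.
Proof. by rewrite -(size_map val) val_ord_enum size_iota. Qed.

Lemma mem_inl_iota (k a b : nat) (l : label k) :
  (l \in [seq inl i | i <- iota a b]) =
  (if l is inl i then a <= i < a + b else false)%N.
Proof.
case: l => [i|j]; last by apply/mapP => -[].
by rewrite mem_map ?mem_iota // => ? ? [].
Qed.

(* The leading copies of V_0 only serve to reach the size 3n. *)
Definition layout (n k : nat) : seq (label k) :=
  nseq (3 * n - (n - k + k + (n - k)))%N (inl 0%N) ++
  vertices (n - k) k ++ [seq inr j | j <- ord_enum k] ++ vertices (n - k) k.

Lemma size_layout (n k : nat) : (k <= n)%N -> size (layout n k) = (3 * n)%N.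
Proof.
by move=> kn; rewrite !size_cat size_nseq !size_map size_ord_enum size_iota; lia.
Qed.

Definition point_labels (n k : nat) : seq (label k) :=
  vertices (n - k) k ++ [seq inr j | j <- ord_enum k].

Lemma mem_point_labels (n k : nat) (l : label k) :
  (l \in point_labels n k) = (if l is inl i then i < n - k else true)%N.
Proof.
rewrite mem_cat mem_inl_iota; case: l => [i|j] /=.
  by case: mapP => [[]//|_]; rewrite orbF.
by rewrite mem_map ?mem_ord_enum // => ? ? [].
Qed.

Lemma mem_layout (n k : nat) (l : label k) : (k < n)%N ->
  (l \in layout n k) = (l \in point_labels n k).
Proof.
move=> kn; rewrite /layout !mem_cat; set v := l \in vertices _ _.
have nv : l \in nseq (3 * n - (n - k + k + (n - k))) (inl 0%N) -> v.
  by rewrite mem_nseq /v => /andP[_ /eqP ->]; apply/map_f; rewrite mem_iota; lia.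
by case: (l \in nseq _ _) nv => [/(_ isT) ->|_] //=; case: v; rewrite ?orbT ?orbF.
Qed.

Lemma uniq_point_labels (n k : nat) : uniq (point_labels n k).
Proof.
rewrite cat_uniq !map_inj_uniq ?iota_uniq ?ord_enum_uniq; try by move=> ? ? [].
by rewrite andbT; apply/hasPn => l /mapP[j _ ->]; apply/mapP => -[].
Qed.

Lemma size_point_labels (n k : nat) : (k <= n)%N -> size (point_labels n k) = n.
Proof. by move=> kn; rewrite size_cat !size_map size_iota size_ord_enum subnK. Qed.

Definition point_set (R : realType) (n k : nat) (pi : {perm 'I_k})
    (o : option 'I_k) : {fset point R} :=
  [fset p in [seq place R pi o l | l <- point_labels n k]]%fset.

Lemma mem_point_set (R : realType) (n k : nat) (pi : {perm 'I_k})
    (o : option 'I_k) (p : point R) :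
  (p \in point_set R n pi o) = (p \in [seq place R pi o l | l <- point_labels n k]).
Proof. by rewrite !inE. Qed.

(** Unlifted Q_j are midpoints of two points of the set, and all other points lie on the parabola
    that bounds the set from above. The hypothesis [k < n - k] supplies the k + 1 vertices that end
    the k edges. *)
Lemma hull_vertex_place (R : realType) (n k : nat) (pi : {perm 'I_k})
    (o : option 'I_k) (p : point R) : (k < n - k)%N ->
  hull_vertex (point_set R n pi o) p <->
  exists2 l, l \in point_labels n k & on_parabola o l /\ p = place R pi o l.
Proof.
move=> kn; split=> [hp|[l lL [ol ->]]].
  have := hull_vertex_mem hp; rewrite mem_point_set => /mapP[l lL e].
  exists l => //; split=> //; apply/negPn/negP => ol.
  case: l ol lL e => // j ol _ e; move: hp.
  have vP i : (i <= k)%N -> place R pi o (inl i) \in point_set R n pi o.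
    by move=> ik; rewrite mem_point_set map_f // mem_point_labels; lia.
  apply: (@midpoint_not_hull_vertex R _ (place R pi o (inl (nat_of_ord (pi j))))
    (place R pi o (inl (pi j).+1))).
  - by apply: vP; apply: ltnW.
  - exact: vP.
  - by apply/eqP => /place_inj[]; lia.
  - by rewrite e /= -!muln2; ring.
  - by move: (ol) => /= /negbTE ol'; rewrite e /= ol' -!muln2 /=; ring.
apply: parabola_hull_vertex => [q||].
- rewrite mem_point_set => /mapP[l' _ ->] /=.
  by rewrite gerDl oppr_le0.
- by rewrite mem_point_set map_f.
- by rewrite /= ol subr0.
Qed.

Definition hull_labels (h k : nat) (pi : {perm 'I_k}) (o : option 'I_k) :
    seq (label k) :=
  if o is Some j then
    vertices (pi j).+1 k ++
    inr j :: [seq inl i | i <- iota (pi j).+1 (h - (pi j).+1)]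
  else vertices h k.

Lemma mem_hull_labels (n k : nat) (pi : {perm 'I_k}) (o : option 'I_k)
    (l : label k) : (k < n - k)%N ->
  (l \in hull_labels (n - k) pi o) = (l \in point_labels n k) && on_parabola o l.
Proof.
move=> kn; rewrite mem_point_labels /hull_labels; case: o => [j|].
  rewrite mem_cat mem_inl_iota in_cons mem_inl_iota; case: l => [i|i] /=.
    have := ltn_ord (pi j); rewrite andbT => ?.
    lia.
  by rewrite orbF eq_sym.
by rewrite mem_inl_iota; case: l => [i|i] /=; rewrite ?andbT.
Qed.

Lemma sorted_ltn_cat_cons (s1 s2 : seq nat) (x : nat) :
  sorted ltn s1 -> sorted ltn s2 -> {in s1, forall y, y < x}%N ->
  {in s2, forall y, x < y}%N -> sorted ltn (s1 ++ x :: s2).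
Proof.
rewrite !(sorted_pairwise ltn_trans) => p1 p2 lt1 lt2.
rewrite pairwise_cat allrel_consr pairwise_cons p1 p2 /= andbT.
have -> : all (ltn x) s2 by apply/allP => y; exact: lt2.
rewrite andbT; apply/andP; split; first by apply/allP => y; exact: lt1.
by apply/allrelP => y z /lt1 yx /lt2; exact: ltn_trans.
Qed.

Lemma sorted_hull_labels (h k : nat) (pi : {perm 'I_k}) (o : option 'I_k) :
  sorted ltn [seq abscissa pi l | l <- hull_labels h pi o].
Proof.
have sv a b : sorted ltn [seq abscissa pi l | l <- [seq inl i | i <- iota a b]].
  rewrite -map_comp sorted_map.
  by apply: sub_sorted (iota_ltn_sorted a b) => x y /=; lia.
rewrite /hull_labels; case: o => [j|]; last exact: sv.
rewrite map_cat map_cons.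
apply: (sorted_ltn_cat_cons (sv 0%N (pi j).+1) (sv (pi j).+1 _)) => y.
all: by rewrite -map_comp => /mapP[i]; rewrite mem_iota => ? /= ->; lia.
Qed.

Lemma subseq_hull_labels (n k : nat) (pi : {perm 'I_k}) (o : option 'I_k) :
  (k < n - k)%N -> subseq (hull_labels (n - k) pi o) (layout n k).
Proof.
move=> kn; apply: subseq_trans (suffix_subseq _ _).
rewrite /hull_labels; case: o => [j|]; last exact: prefix_subseq.
have pk : ((pi j).+1 <= n - k)%N by have := ltn_ord (pi j); lia.
have -> : vertices (n - k) k = vertices (pi j).+1 k ++
    [seq inl i | i <- iota (pi j).+1 (n - k - (pi j).+1)].
  rewrite -map_cat; have := iotaD 0 (pi j).+1 (n - k - (pi j).+1).
  by rewrite subnKC // add0n => <-.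
rewrite -cat1s -[X in subseq _ X]catA; apply: cat_subseq => //.
(* The rest of the first copy of the vertices is skipped before Q_j is picked from the middle
   block. *)
apply: subseq_trans (suffix_subseq _ _); apply: cat_subseq.
  by rewrite sub1seq map_f ?mem_ord_enum.
exact: suffix_subseq.
Qed.

Definition input (R : realType) (m k : nat) (W : m.-tuple (label k))
    (pi : {perm 'I_k}) (o : option 'I_k) : m.-tuple (point R) :=
  [tuple of [seq place R pi o l | l <- W]].

Lemma input_val (R : realType) (m k : nat) (W : m.-tuple (label k))
    (pi : {perm 'I_k}) (o : option 'I_k) :
  input R W pi o = [seq place R pi o l | l <- W] :> seq _.
Proof. by []. Qed.

Lemma lists_vertices_hull_labels (R : realType) (n k : nat) (pi : {perm 'I_k})
    (o : option 'I_k) : (k < n - k)%N ->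
  lists_vertices (point_set R n pi o)
    [seq place R pi o l | l <- hull_labels (n - k) pi o].
Proof.
move=> kn; split.
  rewrite map_inj_uniq; last exact: place_inj.
  rewrite -(map_inj_uniq (@abscissa_inj k pi)).
  exact: (sorted_uniq ltn_trans ltnn (sorted_hull_labels (n - k) pi o)).
move=> p; rewrite hull_vertex_place //; split.
  move=> /mapP[l]; rewrite mem_hull_labels // => /andP[lL ol] ->.
  by exists l.
by move=> [l lL [ol ->]]; rewrite map_f // mem_hull_labels // lL.
Qed.

Lemma valid_layout (R : realType) (n k : nat) (W : (3 * n).-tuple (label k))
    (pi : {perm 'I_k}) (o : option 'I_k) : (k < n - k)%N ->
  W = layout n k :> seq _ ->
  valid_input n (point_set R n pi o) (input R W pi o).
Proof.
move=> kn We; split.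
- rewrite card_fseq undup_id ?map_inj_uniq ?uniq_point_labels //.
    by rewrite size_map size_point_labels; lia.
  exact: place_inj.
- move=> p; rewrite mem_point_set.
  have -> : (p \in input R W pi o) = (p \in [seq place R pi o l | l <- layout n k]).
    by rewrite -We.
  by apply/mapP/mapP => -[l lW ->]; exists l => //; move: lW;
    rewrite mem_layout //; lia.
- exists [seq place R pi o l | l <- hull_labels (n - k) pi o]; split.
  + by rewrite input_val We map_subseq // subseq_hull_labels.
  + exact: lists_vertices_hull_labels.
  + rewrite sorted_map.
    have := sorted_hull_labels (n - k) pi o; rewrite sorted_map.
    by apply: sub_sorted => a b /= ab; rewrite ler_nat ltnW.
Qed.

(** * The adversary argument and the counting of permutations *)

Lemma has_onthP (T : Type) (a : pred T) (s : seq T) :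
  reflect (exists i x, onth s i = Some x /\ a x) (has a s).
Proof.
apply: (iffP idP) => [|[i [x [ix ax]]]]; last first.
  by elim: s i ix => [|y s IH] [|i] //= => [[->]|/IH ->]; rewrite ?ax ?orbT.
elim: s => //= x s IH /orP[ax|/IH[i [y [iy ay]]]]; first by exists 0%N, x.
by exists i.+1, y.
Qed.

Definition hits (m k : nat) (W : m.-tuple (label k)) (pi : {perm 'I_k})
    (j : 'I_k) (e : memory * comparison m) : bool :=
  if e.2 is Orientation a b c then
    edge_test pi [:: tnth W (a e.1); tnth W (b e.1); tnth W (c e.1)] j
  else false.

Lemma tnth_input (R : realType) (m k : nat) (W : m.-tuple (label k))
    (pi : {perm 'I_k}) (o : option 'I_k) (i : 'I_m) :
  tnth (input R W pi o) i = place R pi o (tnth W i).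
Proof. by rewrite tnth_map. Qed.

Lemma eval_input_lift (R : realType) (m k : nat) (W : m.-tuple (label k))
    (pi : {perm 'I_k}) (j : 'I_k) (e : memory * comparison m) :
  ~~ hits W pi j e ->
  eval_comparison (input R W pi None) e.1 e.2 =
  eval_comparison (input R W pi (Some j)) e.1 e.2.
Proof.
case: e => M [a b|a b|a b c] /=; rewrite !tnth_input //.
- by rewrite !lt_place_ordinate.
- exact: strictly_above_lift.
Qed.

(* Lifting Q_j above the edge pi(j) makes it a vertex, so a run that never
   compares Q_j with that edge would give a wrong answer on one of the inputs. *)
Lemma correct_trace_hits (R : realType) (A : algorithm) (n k : nat)
    (W : (3 * n).-tuple (label k)) (pi : {perm 'I_k}) tr out (j : 'I_k) :
  correct R (fun n => 3 * n)%N A -> (k < n - k)%N -> W = layout n k :> seq _ ->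
  exec_trace (A (3 * n)%N) (input R W pi None) 0 (fun=> 0%N) tr out ->
  is_hull_output (point_set R n pi None)
    [seq tnth (input R W pi None) i | i <- out] ->
  has (hits W pi j) tr.
Proof.
move=> corr kn We trace [[_ outP] _]; apply/negPn/negP => nohit.
have [t [c [out' [run' [[_ outP'] _]]]]] :=
  corr n _ _ (valid_layout R pi (Some j) kn We).
have [tr' _ trace'] := exec_exec_trace run'.
(* Without a hit every answer survives the lift, so both runs report the same positions. *)
have [i e ei _|_ eout] := exec_trace_inj trace trace'.
  apply: eval_input_lift; apply: contra nohit => hite.
  by apply/has_onthP; exists i, e.
rewrite -{}eout in outP'.
have : hull_vertex (point_set R n pi (Some j)) (place R pi (Some j) (inr j)).
  rewrite hull_vertex_place //; exists (inr j); first by rewrite mem_point_labels.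
  by rewrite /= eqxx.
move=> /outP' /mapP[i iout]; rewrite tnth_input => /place_inj iW.
(* The reported position that holds the lifted Q_j holds the unlifted one in the other input, where
   it is no vertex. *)
have /outP : place R pi None (inr j) \in
    [seq tnth (input R W pi None) i | i <- out].
  by apply/mapP; exists i => //; rewrite tnth_input iW.
by rewrite hull_vertex_place // => -[l _ [lo /place_inj lj]]; rewrite -lj in lo.
Qed.

Lemma factorial_le_pow4_comparisons (R : realType) (A : algorithm)
    (n k : nat) (B : nat) (W : (3 * n).-tuple (label k)) :
  correct R (fun n => 3 * n)%N A -> (k < n - k)%N -> W = layout n k :> seq _ ->
  (forall pi t c out, runs A (input R W pi None) t c out -> (c <= B)%N) ->
  (k`! <= 4 ^ B)%N.
Proof.
move=> corr kn We bound.
have /choice[tr trP] : forall pi : {perm 'I_k}, exists tr,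
    (size tr <= B)%N /\ (forall j, has (hits W pi j) tr) /\
    exists out, exec_trace (A (3 * n)%N) (input R W pi None) 0 (fun=> 0%N) tr out.
  move=> pi; have [t [c [out [run hull]]]] :=
    corr n _ _ (valid_layout R pi None kn We).
  have [tr sz trace] := exec_exec_trace run; exists tr.
  split; first by rewrite sz; apply: bound run.
  split; last by exists out.
  by move=> j; apply: correct_trace_hits trace hull.
pose bits pi := [seq eval_comparison (input R W pi None) e.1 e.2 | e <- tr pi].
pose marks pi := [seq [exists j, hits W pi j e] | e <- tr pi].
(* Padding with [false] up to length [B] is harmless: codes are only compared at positions inside
   both traces. *)
pose code pi := [ffun i : 'I_B => (nth false (bits pi) i, nth false (marks pi) i)].
suff /leq_card : injective code.
  by rewrite -card_Sn card_ffun card_prod card_bool card_ord; apply: leq_trans.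
move=> pi sigma codeE.
have [sz [hit [out trace]]] := trP pi.
have [sz' [hit' [out' trace']]] := trP sigma.
have codei i e : onth (tr pi) i = Some e -> onth (tr sigma) i = Some e ->
    eval_comparison (input R W pi None) e.1 e.2 =
      eval_comparison (input R W sigma None) e.1 e.2 /\
    [exists j, hits W pi j e] = [exists j, hits W sigma j e].
  move=> ei ei'; have ipi : (i < size (tr pi))%N by rewrite -onthTE ei.
  have isg : (i < size (tr sigma))%N by rewrite -onthTE ei'.
  have := congr1 (fun f : {ffun 'I_B -> bool * bool} =>
    f (Ordinal (leq_trans ipi sz))) codeE.
  rewrite !ffunE /= !(nth_map e) //.
  by rewrite (@onth_nth _ e _ _ _ ei) (@onth_nth _ e _ _ _ ei') => -[-> ->].
have [i e ei ei'|trE _] := exec_trace_inj trace trace'.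
  by have [] := codei i e ei ei'.
(* The traces are now equal, so the comparison that hits j for [pi] is also an edge test for
   [sigma]; its operands determine the common value. *)
apply/permP => j; have /has_onthP[i [e [ei hite]]] := hit j.
have ei' : onth (tr sigma) i = Some e by rewrite -trE.
have [_ markE] := codei i e ei ei'.
have /existsP[j' hite'] : [exists j, hits W sigma j e].
  by rewrite -markE; apply/existsP; exists j.
case: e hite hite' {ei ei' markE} => M [a b|a b|a b c] // hite hite'.
by have [<-] := @edge_test_inj k pi sigma
  [:: tnth W (a M); tnth W (b M); tnth W (c M)] j j' isT hite hite'.
Qed.

(** * Logarithmic estimates *)

(** The quotient k^k / k! is a term of the exponential series at k, so it is at most e^k; take
    logarithms. *)
Lemma ln_factorial_ge (R : realType) (k : nat) :
  k%:R * (ln k%:R - 1) <= ln (k`!)%:R :> R.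
Proof.
case: k => [|k]; first by rewrite mul0r fact0 ln1.
have f0 : 0 < (k.+1)`!%:R :> R by rewrite ltr0n fact_gt0.
have k0 : 0 < k.+1%:R :> R by [].
have h : k.+1%:R ^+ k.+1 / (k.+1)`!%:R <= expR k.+1%:R :> R.
  by apply: le_trans (expR_ge1Dxn k (ltW k0)); rewrite lerDr.
have p0 : 0 < k.+1%:R ^+ k.+1 :> R by rewrite exprn_gt0.
move: h; rewrite -ler_ln ?posrE ?expR_gt0 ?divr_gt0 // expRK.
rewrite ln_div ?posrE // lnXn // -mulr_natl; lra.
Qed.

(** This amounts to e^2 <= 16: from e^(-1/2) >= 1/2 follows e^(1/2) <= 2, and the fourth power is
    taken. *)
Lemma ln_ge2 (R : realType) (x : R) : 16 <= x -> 2 <= ln x.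
Proof.
move=> x16; have x0 : 0 < x by lra.
rewrite -[leLHS]expRK ler_ln ?posrE ?expR_gt0 //; apply: le_trans x16.
have lo : 2^-1 <= expR (- 2^-1) :> R by have := @expR_ge1Dx R (- 2^-1); lra.
have inv : expR (- 2^-1) * expR 2^-1 = 1 :> R by rewrite -expRD addNr expR0.
have hi : expR 2^-1 <= 2 :> R.
  have := ler_wpM2r (expR_ge0 (2^-1 : R)) lo; rewrite inv; lra.
have -> : (2 : R) = 4%:R * 2^-1 by lra.
rewrite expRM_natl (_ : 16 = 2 ^+ 4); last by ring.
by rewrite lerXn2r ?nnegrE ?expR_ge0.
Qed.

Lemma nlogn_le_ln_factorial (R : realType) (n : nat) : (200 <= n)%N ->
  n%:R * ln n%:R <= 6 * ln ((n.-1)./2`!)%:R :> R.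
Proof.
move=> n200; set k := (n.-1)./2.
have k0 : 0 < k%:R :> R by rewrite ltr0n /k; lia.
have n0 : 0 < n%:R :> R by rewrite ltr0n; lia.
have kn : n%:R <= 3 * k%:R :> R by rewrite -natrM ler_nat /k; lia.
(* Since n <= 3k and k >= 48, k^2 >= 16 n. This gives ln n <= 2 (ln k - 1), so n ln n <= 6 k (ln k -
   1). *)
have : 2 <= ln (k%:R ^+ 2 / n%:R) :> R.
  apply: ln_ge2; rewrite ler_pdivlMr // -natrX -natrM ler_nat.
  have nk : (n <= 3 * k)%N by rewrite /k; lia.
  have k48 : (48 <= k)%N by rewrite /k; lia.
  nia.
rewrite ln_div ?posrE ?exprn_gt0 // lnXn // => h.
have := ln_factorial_ge R k.
have l0 : 0 <= ln n%:R :> R by rewrite ln_ge0 // ler1n; lia.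
have h2 : ln n%:R <= 2 * (ln k%:R - 1) :> R by rewrite mulr2n in h; lra.
nra.
Qed.

(** * The asymptotic bounds *)

Lemma correct_comparisons_Omega_nlogn (R : realType) (A : algorithm) :
  correct R (fun n => 3 * n)%N A ->
  comparisons_Omega_nlogn R (fun n => 3 * n)%N A.
Proof.
(* The constant is 48 = 2 * 6 * 4: if every run made fewer comparisons, then n ln n <= 6 ln k! <= 6
   B ln 4 <= 24 B would be at most half of n ln n. The choice of [k] is the largest one with
   [k < n - k]. *)
move=> corr; exists (48^-1 : R); first lra.
exists 200%N => n n200; pose k := (n.-1)./2.
have kn : (k < n - k)%N by rewrite /k; lia.
have szW : size (layout n k) == (3 * n)%N by apply/eqP/size_layout; lia.
pose W : (3 * n).-tuple (label k) := Tuple szW.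
have [|small] := pselect (exists pi t c out, runs A (input R W pi None) t c out /\
    48^-1 * (n%:R * ln n%:R) <= c%:R :> R).
  move=> [pi [t [c [out [run big]]]]].
  exists (point_set R n pi None), (input R W pi None), t, c, out.
  by split=> //; apply: valid_layout.
have nlogn0 : 0 < 48^-1 * (n%:R * ln n%:R) :> R.
  by rewrite !mulr_gt0 ?ln_gt0 ?ltr0n ?ltr1n ?invr_gt0 //; lia.
pose B := Num.truncn (48^-1 * (n%:R * ln n%:R) : R).
have bound pi t c out : runs A (input R W pi None) t c out -> (c <= B)%N.
  move=> run; rewrite Num.Theory.truncn_ge_nat; last exact: ltW.
  rewrite leNgt; apply/negP => big.
  by apply: small; exists pi, t, c, out; split=> //; apply: ltW.
exfalso; have WE : W = layout n k :> seq _ by [].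
have := factorial_le_pow4_comparisons corr kn WE bound.
rewrite -(ler_nat R) natrX -ler_ln ?posrE ?exprn_gt0 ?ltr0n ?fact_gt0 //.
rewrite lnXn // -[leRHS]mulr_natr => factB.
have ln4 : ln 4 <= 4 :> R by apply/ltW/ln_sublinear.
have B0 : 0 <= B%:R :> R by [].
have Ble : B%:R <= 48^-1 * (n%:R * ln n%:R) :> R by rewrite truncn_le ltW.
have := nlogn_le_ln_factorial R n200; rewrite -/k.
have := ler_wpM2r B0 ln4; lra.
Qed.

Theorem mainTheorem4 (R : realType) :
  (forall A : algorithm,
     correct R (fun n => 3 * n)%N A ->
     comparisons_Omega_nlogn R (fun n => 3 * n)%N A) /\
  (exists2 m : nat -> nat, linearly_bounded m &
     ~ exists A : algorithm, correct R m A /\ time_o_nlogn R m A).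
Proof.
split; first exact: correct_comparisons_Omega_nlogn.
exists (fun n => 3 * n)%N; first by exists 3%N, 0%N.
move=> [A [corr fast]].
have [r r0 [N slow]] := correct_comparisons_Omega_nlogn corr.
(* Each comparison takes one time step, so half the lower-bound constant is contradictory once n ln
   n > 0; the summand 2 in [n] ensures this. *)
have [|N' fast'] := fast (r / 2); first lra.
pose n := (N + N' + 2)%N.
have [|P [I [t [c [out [valid run big]]]]]] := slow n; first by rewrite /n; lia.
have := fast' n _ P I t c out valid run; rewrite {1}/n => /(_ ltac:(lia)) tle.
have ct : c%:R <= t%:R :> R by rewrite ler_nat; apply: exec_comparisons_le_time run.
have : 0 < r * (n%:R * ln n%:R) :> R.
  by rewrite !mulr_gt0 ?ln_gt0 ?ltr0n ?ltr1n // /n; lia.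
lra.
Qed.
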